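(* A finite abelian group $G$ has a perfect restricted $2$-basis if, and only if, $G$ is isomorphic to one of $\mathbb{Z}_2$, $\mathbb{Z}_4$, $\mathbb{Z}_7$, $\mathbb{Z}_2^2$, $\mathbb{Z}_2^4$, or $\mathbb{Z}_2^2\times\mathbb{Z}_4$.
   Context: $G$ is written additively. A subset $A\subseteq G$ is a perfect restricted $s$-basis of $G$ if every element of $G$ can be written as a sum of at most $s$ pairwise distinct elements of $A$ (the empty sum giving $0$), and this representation is unique apart from the order of the terms; equivalently, the sums $\sum_{a\in S}a$ over subsets $S\subseteq A$ with $|S|\le s$ are pairwise distinct and cover $G$. $\mathbb{Z}_n=\mathbb{Z}/n\mathbb{Z}$.
   Formalization: The group G is assumed nontrivial: the trivial group has the empty set as a perfect restricted 2-basis but is isomorphic to none of the listed groups, so the statement fails for it alone. *)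

(* Defs.v *)
From HB Require Import structures.
From mathcomp Require Import all_boot all_order all_algebra all_fingroup.

Set Implicit Arguments.
Unset Strict Implicit.
Unset Printing Implicit Defensive.

Import GRing.Theory.
Local Open Scope ring_scope.

(* A sum of pairwise distinct elements of A, up to the order of the terms, is
   given by the set S of its terms; S = set0 gives the empty sum 0. *)
Definition perfect_restricted_basis (G : finZmodType) (s : nat)
    (A : {set G}) : Prop :=
  forall g : G, exists! S : {set G},
    [/\ S \subset A, (#|S| <= s)%N & \sum_(a in S) a = g].

(* Main.v *)
Require Import Defs.
From HB Require Import structures.
From mathcomp Require Import all_boot all_order all_algebra all_fingroup.
From mathcomp Require Import all_solvable zify.

(* Adjoining 0 to a perfect restricted 2-basis gives a set B such that every
   nonzero element of G is the sum of exactly one 2-element subset of B, and 0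
   is the sum of none. If two pairs of B have the same difference d, then they
   are consecutive in a progression of difference d, and every b in B is the
   midpoint of at most one nondegenerate progression in B (of none if 2b = 0).
   Counting differences, at most 4u ordered pairs (b, c) in B satisfy
   2b <> 2c, where u is the number of b in B with 2b <> 0. If u = 0, then G is
   an elementary abelian 2-group, and an index 2 subgroup splits B into parts
   of sizes p and q with 2pq = #|G|, so both are powers of 2. If u > 0, then at
   most two elements of B are killed by 2, and all but at most two of the others
   have the same double; counting the sums that lie in a coset of the 2-torsion
   then bounds #|B|. *)

Section PerfectBases.
Set Implicit Arguments.
Unset Strict Implicit.
Unset Printing Implicit Defensive.
Import GRing.Theory.
Local Open Scope ring_scope.

Implicit Type G : finZmodType.

Lemma card_subsets_le2 G (A : {set G}) :
  #|[set S : {set G} | (S \subset A) && (#|S| <= 2)%N]| = (1 + #|A| + 'C(#|A|, 2))%N.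
Proof.
pose D i := [set S : {set G} | S \subset A & #|S| == i].
have -> : [set S : {set G} | (S \subset A) && (#|S| <= 2)%N] = D 0%N :|: D 1%N :|: D 2%N.
  apply/setP=> S; rewrite !inE; case: (S \subset A) => //=.
  by case: #|S| => [|[|[|]]].
have dis i j : i != j -> #|D i :&: D j| = 0%N.
  move=> ij; apply/eqP; rewrite cards_eq0; apply/eqP/setP=> S; rewrite !inE.
  apply/negP=> /andP[/andP[_ /eqP h1] /andP[_ /eqP h2]].
  by rewrite -h1 -h2 eqxx in ij.
rewrite cardsU setIUl cardsU.
have -> : D 0%N :&: D 2%N :|: D 1%N :&: D 2%N = set0.
  by apply/eqP; rewrite -cards_eq0 cardsU !dis.
by rewrite cards0 dis // !subn0 !cards_draws bin0 bin1.
Qed.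

Lemma perfect_of_cover G (A : {set G}) : #|G| = (1 + #|A| + 'C(#|A|, 2))%N ->
  (forall g, exists S : {set G}, [/\ S \subset A, (#|S| <= 2)%N & \sum_(a in S) a = g]) ->
  perfect_restricted_basis 2 A.
Proof.
rewrite -card_subsets_le2.
set D := [set S : {set G} | _]; pose f (S : {set G}) := \sum_(a in S) a => cA sA.
have fD : f @: D = [set: G].
  apply/setP=> g; rewrite inE; have [S [S1 S2 S3]] := sA g.
  by apply/imsetP; exists S => //; rewrite inE S1 S2.
have injf : {in D &, injective f} by apply/imset_injP; rewrite fD cardsT cA.
move=> g; have [S [S1 S2 S3]] := sA g; exists S; split=> // T [T1 T2 T3].
by apply: injf; rewrite ?inE ?S1 ?T1 //= /f S3 T3.
Qed.

Lemma perfect_of_isog (gT : finGroupType) G (isoG : [set: G] \isog [set: gT])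
    (l : seq gT) :
  uniq l -> #|gT| = (1 + size l + 'C(size l, 2))%N ->
  size (undup (1%g :: l ++ [seq (p.1 * p.2)%g | p <- [seq (x, y) | x <- l, y <- l]
                                              & p.1 != p.2])) = #|gT| ->
  exists A : {set G}, perfect_restricted_basis 2 A.
Proof.
move: isoG; rewrite isog_sym => /isogP[f injf fG] ul cG; set s := (X in undup X) => cs.
have fD : {morph f : x y / (x * y)%g >-> x + y} by move=> x y; exact: (morphM f).
have f0 : f 1%g = 0 by exact: (morph1 f).
have finj : injective f by move=> x y e; apply: (injmP injf) => //; rewrite inE.
have cA : #|[set x in l]| = size l by rewrite cardsE (card_uniqP ul).
exists (f @: [set x in l]); apply: perfect_of_cover; rewrite ?card_imset ?cA //.
  by rewrite -cG -!cardsT -fG card_injm.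
have fulls g : g \in s.
  have /subset_cardP/(_ (subset_predT _))/(_ g) : #|undup s| = #|gT|.
    by rewrite (card_uniqP (undup_uniq s)).
  by rewrite mem_undup.
move=> h; have : h \in [set: G] by rewrite inE.
rewrite -fG => /morphimP[g _ _ ->].
have := fulls g; rewrite inE mem_cat.
case/or3P=> [/eqP->|gl|/mapP[[a b]]].
- by exists set0; rewrite sub0set cards0 big_set0 f0.
- by exists [set f g]; rewrite sub1set imset_f ?inE // cards1 big_set1.
rewrite mem_filter /= => /andP[ab /allpairsP[[x y] /= [al bl [ax bY]]]] ->.
rewrite -{}ax -{}bY in al bl; exists [set f a; f b].
rewrite subUset !sub1set !imset_f ?inE ?al ?bl // cards2; split=> //.
  by case: (_ != _).
by rewrite big_setU1 ?inE ?(inj_eq finj) //= big_set1 fD.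
Qed.

Lemma perfect_basis_exists G :
  [|| [set: G] \isog [set: 'Z_2],
      [set: G] \isog [set: 'Z_4],
      [set: G] \isog [set: 'Z_7],
      [set: G] \isog [set: 'Z_2 * 'Z_2],
      [set: G] \isog [set: 'Z_2 * 'Z_2 * 'Z_2 * 'Z_2]
    | [set: G] \isog [set: 'Z_2 * 'Z_2 * 'Z_4]] ->
  exists A : {set G}, perfect_restricted_basis 2 A.
Proof.
case/or4P=> [iG|iG|iG|/or3P[iG|iG|iG]].
- by apply: (@perfect_of_isog _ _ iG [:: 1]%R); rewrite ?card_ord.
- by apply: (@perfect_of_isog _ _ iG [:: 1; 2]%R); rewrite ?card_ord.
- by apply: (@perfect_of_isog _ _ iG [:: 1; 2; 4]%R); rewrite ?card_ord.
- by apply: (@perfect_of_isog _ _ iG [:: (1, 0); (0, 1)]%R); rewrite ?card_prod ?card_ord.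
- apply: (@perfect_of_isog _ _ iG [:: (1, 0, 0, 0); (0, 1, 0, 0); (0, 0, 1, 0);
    (0, 0, 0, 1); (1, 1, 1, 1)]%R); rewrite ?card_prod ?card_ord //.
- apply: (@perfect_of_isog _ _ iG [:: (0, 0, 1); (0, 0, 2); (0, 1, 1);
    (1, 0, 1); (1, 1, 3)]%R); rewrite ?card_prod ?card_ord //.
Qed.

Definition pair_basis G (B : {set G}) : Prop :=
  [/\ 0 \in B,
      forall g, g != 0 -> exists a b, [/\ a \in B, b \in B, a != b & g = a + b],
      {in B &, forall a b, a != b -> a + b != 0} &
      {in B & &, forall a b c, {in B, forall d, a != b -> c != d -> a + b = c + d ->
         a = c /\ b = d \/ a = d /\ b = c}}].

Lemma perfect_pair_basis G (A : {set G}) :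
  perfect_restricted_basis 2 A -> pair_basis (0 |: A).
Proof.
move=> pA.
have uA (S T : {set G}) : S \subset A -> T \subset A -> (#|S| <= 2)%N -> (#|T| <= 2)%N ->
    \sum_(a in S) a = \sum_(a in T) a -> S = T.
  move=> SA TA S2 T2 e; have [X [_ u]] := pA (\sum_(a in T) a).
  by rewrite -(u S) // -(u T).
have A0 : 0 \notin A.
  apply/negP=> A0; have : [set 0] = set0 :> {set G}.
    by apply: uA; rewrite ?sub1set ?sub0set ?cards1 ?cards0 // big_set1 big_set0.
  by move/setP/(_ 0); rewrite !inE eqxx.
pose S (a b : G) := [set a; b] :\ 0.
have SA a b : a \in 0 |: A -> b \in 0 |: A -> S a b \subset A.
  move=> aB bB; apply/subsetP=> x; rewrite !inE => /andP[x0 /orP[] /eqP e]; subst x.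
    by move: aB; rewrite !inE (negbTE x0).
  by move: bB; rewrite !inE (negbTE x0).
have Scard (a b : G) : a != b -> (#|S a b| + (0%R \in [set a; b]) = 2)%N.
  by move=> ab; rewrite addnC -cardsD1 cards2 ab.
have Ssum (a b : G) : a != b -> \sum_(x in S a b) x = a + b.
  move=> ab; have <- : \sum_(x in [set a; b]) x = a + b.
    by rewrite big_setU1 ?inE //= big_set1.
  case: (boolP (0 \in [set a; b])) => h.
    by rewrite [RHS](big_setD1 0) //= add0r.
  by have -> : S a b = [set a; b] by apply/setDidPl; rewrite disjoint_sym disjoints1.
split.
- by rewrite !inE eqxx.
- move=> g g0; have [T [[TA T2 Tg] _]] := pA g.
  have : (0 < #|T|)%N.
    by rewrite lt0n; apply: contraNneq g0 => /cards0_eq T0; rewrite -Tg T0 big_set0.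
  move: T2; rewrite leq_eqVlt => /orP[/cards2P[x [y [xy eT]]] _|T1 T0].
    exists x, y; rewrite -Tg eT big_setU1 ?inE //= big_set1; split=> //.
      by rewrite (subsetP TA) ?orbT // eT !inE eqxx.
    by rewrite (subsetP TA) ?orbT // eT !inE eqxx orbT.
  have /cards1P[x eT] : #|T| == 1%N by lia.
  have xA : x \in A by rewrite (subsetP TA) // eT inE.
  exists 0, x; rewrite -Tg eT big_set1 add0r !inE eqxx xA orbT; split=> //.
  by apply: contraNneq A0 => ->.
- move=> a b aB bB ab; apply/eqP=> ab0.
  have e : S a b = set0.
    apply: uA; rewrite ?SA ?sub0set ?cards0 ?Ssum ?ab0 ?big_set0 //.
    by have := Scard _ _ ab; lia.
  by have := Scard _ _ ab; rewrite e cards0; case: (_ \in _).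
- move=> a b c aB bB cB d dB ab cd e.
  have eS : S a b = S c d.
    apply: uA; rewrite ?SA ?Ssum //.
      by have := Scard _ _ ab; lia.
    by have := Scard _ _ cd; lia.
  have e2 : [set a; b] = [set c; d].
    have e0 : (0 \in [set a; b]) = (0 \in [set c; d]).
      by have := Scard _ _ ab; have := Scard _ _ cd; rewrite eS; do 2!case: (0 \in _) => //=; lia.
    apply/setP=> x; case: (eqVneq x 0) => [->//|x0].
    by have /setP/(_ x) := eS; rewrite !in_setD1 x0.
  have : a \in [set c; d] by rewrite -e2 !inE eqxx.
  have : b \in [set c; d] by rewrite -e2 !inE eqxx orbT.
  rewrite !inE => /orP[]/eqP eb /orP[]/eqP ea; subst.
  + by rewrite eqxx in ab.
  + by right.
  + by left.
  + by rewrite eqxx in ab.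
Qed.

Lemma card_dep_pairs (T : finType) (C : {set T}) (D : T -> {set T}) :
  #|[set p : T * T | (p.1 \in C) && (p.2 \in D p.1)]| = (\sum_(a in C) #|D a|)%N.
Proof.
rewrite -sum1_card.
under [RHS]eq_bigr => a _ do rewrite -sum1_card.
by rewrite pair_big_dep; apply: eq_bigl => p; rewrite inE.
Qed.

Lemma card_offdiag (T : finType) (C : {set T}) :
  #|[set p : T * T | (p.1 \in C) && (p.2 \in C :\ p.1)]| = (#|C| * #|C|.-1)%N.
Proof.
rewrite (card_dep_pairs C (fun a => C :\ a)) -sum_nat_const; apply: eq_bigr => a aC.
by rewrite (cardsD1 a C) aC.
Qed.

Lemma card_pairs_sum G (B X : {set G}) : pair_basis B ->
  #|[set p : G * G | [&& p.1 \in B, p.2 \in B :\ p.1 & p.1 + p.2 \in X]]|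
  = (#|X :\ 0%R| * 2)%N.
Proof.
case=> _ cov nz inj; rewrite -sum1_card.
rewrite (partition_big (fun p => p.1 + p.2) (mem (X :\ 0))) /=; last first.
  move=> [a b]; rewrite !inE /= eq_sym => /and3P[aB /andP[ab bB] ->].
  by rewrite andbT nz.
rewrite -sum_nat_const; apply: eq_bigr => g; rewrite !inE => /andP[g0 gX].
have [a [b [aB bB ab eg]]] := cov g g0.
rewrite sum1_card -[RHS](_ : #|[set (a, b); (b, a)]| = 2%N); last first.
  by rewrite cards2 xpair_eqE negb_and ab.
apply: eq_card => -[c d]; rewrite [LHS]unfold_in /= !inE /= !xpair_eqE.
apply/andP/orP=> [[/and3P[cB /andP[dc dB] _] /eqP e]|[]/andP[/eqP-> /eqP->]].
- rewrite eq_sym in dc; rewrite eg in e.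
  have [[-> ->]|[-> ->]] := inj _ _ _ cB dB aB _ bB dc ab e; rewrite !eqxx; [by left|by right].
- by rewrite aB bB -eg gX eq_sym ab.
- by rewrite aB bB ab addrC -eg gX.
Qed.

Lemma card_pair_basis G (B : {set G}) : pair_basis B ->
  (#|B| * #|B|.-1 + 2 = #|G| * 2)%N.
Proof.
move=> pB; have := card_pairs_sum setT pB; rewrite -card_offdiag.
have cG : #|G| = #|[set: G] :\ 0|.+1 by rewrite -cardsT (cardsD1 0) in_setT.
rewrite (_ : [set p : G * G | [&& _, _ & _]] =
   [set p | (p.1 \in B) && (p.2 \in B :\ p.1)]); first by rewrite cG => ->; lia.
by apply/setP=> p; rewrite !inE andbT.
Qed.

(* Split the pairs [(b, c)] according to whether [2b - c], which would continue the progression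
   [c, b], lies in [B]. *)
Lemma nondegenerate_pairs_bound G (B : {set G}) : pair_basis B ->
  (\sum_(b in B) #|[set c in B | c *+ 2 != b *+ 2]|
     <= 4 * #|[set b in B | b *+ 2 != 0%R]|)%N.
Proof.
move=> pB; have cB := card_pair_basis pB; case: pB => B0 cov nz inj.
set U := [set b in B | b *+ 2 != 0]; pose M := [set d : G | d *+ 2 != 0].
rewrite -card_dep_pairs; set P := [set p | _].
pose mid := [set p : G * G | p.1 *+ 2 - p.2 \in B].
have P1 : (#|P :&: mid| <= 2 * #|U|)%N.
  pose D (b : G) := [set c in B | (b *+ 2 - c \in B) && (c *+ 2 != b *+ 2)].
  have cD b c : c \in D b -> c != b *+ 2 - c.
    by rewrite !inE => /and3P[_ _]; apply: contraNneq => e; rewrite {1}mulr2n {2}e addrC subrK.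
  have D2 b : (#|D b| <= 2)%N.
    case: (set_0Vmem (D b)) => [->|[c cDb]]; first by rewrite cards0.
    apply: (@leq_trans #|[set c; b *+ 2 - c]|); last by rewrite cards2; case: (_ != _).
    apply/subset_leq_card/subsetP=> x xDb; have := cD _ _ xDb; have := cD _ _ cDb.
    move: cDb xDb; rewrite !inE => /and3P[c1 c2 _] /and3P[x1 x2 _] cc xx.
    have e : x + (b *+ 2 - x) = c + (b *+ 2 - c) by rewrite ![_ + (b *+ 2 - _)]addrCA !subrr.
    by have [[-> _]|[-> _]] := inj _ _ _ x1 x2 c1 _ c2 xx cc e; rewrite eqxx ?orbT.
  apply: (@leq_trans #|[set p : G * G | (p.1 \in U) && (p.2 \in D p.1)]|).
    apply/subset_leq_card/subsetP=> -[b c]; rewrite !inE /=.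
    move=> /andP[/andP[-> /andP[cB' cb]] bcB].
    rewrite cB' cb bcB /= !andbT; apply/eqP=> b0; rewrite b0 sub0r in bcB cb.
    have cN : c != - c by apply: contraNneq cb => e; rewrite mulr2n {1}e addNr.
    by have := nz _ _ cB' bcB cN; rewrite subrr eqxx.
  rewrite card_dep_pairs mulnC -sum_nat_const; exact: leq_sum.
have P2 : (#|P :\: mid| <= #|M|)%N.
  pose f (p : G * G) := p.2 - p.1.
  have injf : {in P :\: mid &, injective f}.
    move=> [b c] [b' c']; rewrite !inE /f /=.
    move=> /andP[m1 /andP[bB /andP[cB' n1]]] /andP[m2 /andP[b'B /andP[c'B n2]]].
    move=> e; have e2 : c + b' = c' + b.
      by rewrite -[c](subrK b) e addrAC subrK.
    have [cb'|cb'] := eqVneq c b'.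
      subst b'; case/negP: m2.
      suff -> : c *+ 2 - c' = b by [].
      by rewrite mulr2n e2 addrAC subrr add0r.
    have [bc'|bc'] := eqVneq c' b.
      subst c'; case/negP: m1.
      suff -> : b *+ 2 - c = b' by [].
      by rewrite mulr2n -e2 addrAC subrr add0r.
    have [[-> ->]//|[cb _]] := inj _ _ _ cB' b'B c'B _ bB cb' bc' e2.
    by rewrite cb eqxx in n1.
  rewrite -(card_in_imset injf); apply/subset_leq_card/subsetP=> d /imsetP[[b c]].
  by rewrite !inE /f /= => /andP[_ /andP[_ /andP[_ n1]]] ->; rewrite mulrnBl subr_eq0.
pose Z := [set p : G * G | (p.1 \in B) && (p.2 \in B :\ p.1)] :\: P.
have cPZ : (#|P| + #|Z| = #|B| * #|B|.-1)%N.
  rewrite -card_offdiag -[RHS](cardsID P); congr addn; apply: eq_card => -[b c].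
  rewrite !inE /=; case: (b \in B) => //=; case: (c \in B); rewrite /= ?andbF //.
  rewrite andbT; case: (eqVneq c b) => [->|_]; first by rewrite eqxx.
  by [].
have cZ : (#|Z| <= #|~: M :\ 0%R| * 2)%N.
  rewrite -sum1_card (partition_big (fun p => p.2 - p.1) (mem (~: M :\ 0))) /=; last first.
    move=> [b c]; rewrite !inE /= => /andP[h /and3P[bB cb cB']]; move: h.
    by rewrite bB cB' /= negbK mulrnBl !subr_eq0 cb => ->.
  have -> : (#|~: M :\ 0%R| * 2 = \sum_(d in ~: M :\ 0%R) 2)%N by rewrite sum_nat_const.
  apply: leq_sum => d _; rewrite sum1_card.
  set F := (X in #|X|).
  case: (pickP F) => [[b c] hbc|F0]; last by rewrite (eq_card F0) card0.
  apply: (@leq_trans #|[set (b, c); (c, b)]|); last by rewrite cards2; case: (_ != _).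
  apply/subset_leq_card/subsetP=> -[b' c'].
  move: hbc; rewrite [_ \in F]unfold_in /F /= !inE /= !xpair_eqE.
  move=> /andP[/andP[z1 /and3P[bB cb cB']] /eqP e1].
  move=> /andP[/andP[z2 /and3P[b'B cb' c'B]] /eqP e].
  rewrite bB cB' /= negbK in z1.
  have e2 : c + b' = c' + b by rewrite -[c](subrK b) e1 -e addrAC subrK.
  have [eb|nb] := eqVneq c b'.
    subst b'; suff -> : c' = b by rewrite !eqxx orbT.
    by apply: (addIr b); rewrite -e2 -!mulr2n (eqP z1).
  have [ec|nc] := eqVneq c' b.
    by case/eqP: nb; apply: (addrI c); rewrite e2 ec -!mulr2n (eqP z1).
  have [[-> ->]|[cb2 _]] := inj _ _ _ cB' b'B c'B _ bB nb nc e2; first by rewrite !eqxx.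
  by rewrite cb2 eqxx in cb.
have cM : #|G| = (#|~: M :\ 0%R| + #|M|).+1.
  rewrite -(cardsC M) (cardsD1 0 (~: M)) !inE mul0rn eqxx /=. by rewrite add1n addnS addnC.
have P12 := cardsID mid P.
lia.
Qed.

Definition torsion2 G : {set G} := [set g | g *+ 2 == 0].

Lemma card_double_fiber G (b : G) : #|[set g : G | g *+ 2 == b *+ 2]| = #|torsion2 G|.
Proof.
rewrite -[RHS](card_imset _ (addIr b)); congr #|pred_of_set _|; apply/setP=> g.
apply/idP/imsetP=> [|[d]]; rewrite !inE.
  by move=> /eqP e; exists (g - b); rewrite ?subrK // inE mulrnBl e subrr.
by move=> /eqP e ->; rewrite mulrnDl e add0r.
Qed.

Lemma card_same_fiber_pairs G (B C : {set G}) b : pair_basis B -> C \subset B ->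
  {in C, forall c, c *+ 2 = b *+ 2} -> (#|C| * #|C|.-1 <= #|torsion2 G| * 2)%N.
Proof.
move=> pB CB hC; set X := [set g : G | g *+ 2 == (b + b) *+ 2].
apply: (@leq_trans (#|X :\ 0%R| * 2)%N); last first.
  by rewrite leq_mul2r /= -(card_double_fiber (b + b)) subset_leq_card ?subsetDl.
rewrite -(card_pairs_sum X pB) -card_offdiag.
apply/subset_leq_card/subsetP=> -[a c]; rewrite !inE /= => /andP[aC /andP[ca cC]].
by rewrite !(subsetP CB) // ca !mulrnDl (hC a aC) (hC c cC) eqxx.
Qed.

Lemma sum_nondegenerate_pairs G (B : {set G})
    (T := [set b in B | b *+ 2 == 0]) (U := [set b in B | b *+ 2 != 0]) :
  (\sum_(b in B) #|[set c in B | c *+ 2 != b *+ 2]| =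
   2 * #|T| * #|U| + \sum_(b in U) #|[set c in U | c *+ 2 != b *+ 2]|)%N.
Proof.
rewrite (bigID (mem T)) /=.
have -> : (\sum_(b in B | b \in T) #|[set c in B | c *+ 2 != b *+ 2]| = #|T| * #|U|)%N.
  rewrite -sum_nat_const; apply: eq_big => b; rewrite !inE; first by case: (b \in B).
  move=> /andP[_ /andP[_ /eqP->]]; apply: eq_card => c.
  by rewrite !inE.
have -> : (\sum_(b in B | b \notin T) #|[set c in B | c *+ 2 != b *+ 2]| =
   \sum_(b in U) (#|T| + #|[set c in U | c *+ 2 != b *+ 2]|))%N.
  apply: eq_big => b; rewrite !inE; first by case: (b \in B).
  move=> /andP[bB]; rewrite bB /= => b0.
  rewrite -(cardsID T); congr addn; apply: eq_card => c; rewrite !inE.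
    case: (c \in B) => //=; case: (eqVneq (c *+ 2) 0) => [->|_]; rewrite ?andbF //.
    by rewrite eq_sym b0.
  by case: (c \in B); rewrite ?andbF.
by rewrite big_split /= sum_nat_const [(#|U| * _)%N]mulnC addnA addnn -mul2n mulnA.
Qed.

Lemma card_split_torsion G (B : {set G}) :
  #|B| = (#|[set b in B | b *+ 2 == 0%R]| + #|[set b in B | b *+ 2 != 0%R]|)%N.
Proof.
rewrite -(cardsID (torsion2 G)); congr addn; apply: eq_card => c; rewrite !inE.
  by [].
by rewrite andbC.
Qed.

Lemma card_fiber_split G (U : {set G}) b :
  #|U| = (#|[set c in U | c *+ 2 == b *+ 2]| + #|[set c in U | c *+ 2 != b *+ 2]|)%N.
Proof.
rewrite -(cardsID [set c | c *+ 2 == b *+ 2]); congr addn; apply: eq_card => c; rewrite !inE.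
  by [].
by rewrite andbC.
Qed.

Lemma sum_fiber_complement_ge G (U : {set G}) b :
  (2 * #|[set c in U | c *+ 2 == b *+ 2]| * #|[set c in U | c *+ 2 != b *+ 2]|
   <= \sum_(a in U) #|[set c in U | c *+ 2 != a *+ 2]|)%N.
Proof.
set C := [set c in U | _ == _]; set W := [set c in U | c *+ 2 != _].
rewrite (bigID (mem C)) /= -mulnA mul2n -addnn; apply: leq_add.
  rewrite -sum_nat_const [X in (_ <= X)%N](eq_bigl (mem C)); last by move=> a; rewrite !inE; case: (a \in U).
  by apply: leq_sum => a; rewrite inE => /andP[_ /eqP ->].
rewrite mulnC -sum_nat_const [X in (_ <= X)%N](eq_bigl (mem W)); last first.
  by move=> a; rewrite !inE; case: (a \in U).
apply: leq_sum => a; rewrite inE => /andP[_ ab].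
apply/subset_leq_card/subsetP=> c; rewrite !inE => /andP[-> /eqP->].
by rewrite eq_sym.
Qed.

Lemma pair_basis_one_torsion G (B : {set G}) : pair_basis B ->
  [set b in B | b *+ 2 == 0] = [set 0] -> (0 < #|[set b in B | b *+ 2 != 0%R]|)%N ->
  (#|B| <= 5)%N.
Proof.
move=> pB T1 U0; have := nondegenerate_pairs_bound pB.
rewrite sum_nondegenerate_pairs (card_split_torsion B) T1 cards1 muln1.
set U := [set b in B | _ != _] in U0 *; set S := (X in (_ + X <= _)%N) => bS.
have [b bU wb] : exists2 b, b \in U & (#|[set c in U | c *+ 2 != b *+ 2]| <= 2)%N.
  apply/exists_inP; apply: contraLR bS; rewrite negb_exists_in => /forall_inP h.
  have : (\sum_(b in U) 3 <= S)%N by apply: leq_sum => b /h; rewrite ltnNge.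
  rewrite sum_nat_const; lia.
have := sum_fiber_complement_ge U b; rewrite -/S (card_fiber_split U b) in bS *.
have : (#|[set c in U | c *+ 2 != b *+ 2]| <= 1 -> #|[set c in U | c *+ 2 == b *+ 2]| <= 3)%N.
  move=> w1; set C := [set c in U | _ == _].
  have b0 : b *+ 2 != 0 by move: bU; rewrite inE => /andP[].
  have CK : C = [set g : G | g *+ 2 == b *+ 2].
    apply/setP=> g; rewrite !inE; case: (eqVneq (g *+ 2) (b *+ 2)) => [gb|]; rewrite ?andbF // gb b0 ?andbT.
    case: pB => B0 cov _ _.
    have [|a [c [aB cB ac eg]]] := cov g.
      by apply: contraNneq b0 => g0; rewrite -gb g0 mul0rn.
    have inU x : x \in B -> x != 0 -> x \in U.
      move=> xB x0; rewrite inE xB; apply: contra x0 => x2.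
      by have /setP/(_ x) := T1; rewrite !inE xB x2.
    have [a0|/(inU _ aB) aU] := eqVneq a 0; first by rewrite eg a0 add0r.
    have [c0|/(inU _ cB) cU] := eqVneq c 0; first by rewrite eg c0 addr0.
    have [ab|ab] := eqVneq (a *+ 2) (b *+ 2).
      move: cU; rewrite inE cB /= => /negP[]; rewrite -(inj_eq (addrI (a *+ 2))) addr0.
      by rewrite -mulrnDl -eg gb ab.
    have [cb|cb] := eqVneq (c *+ 2) (b *+ 2).
      move: aU; rewrite inE aB /= => /negP[]; rewrite -(inj_eq (addIr (c *+ 2))) add0r.
      by rewrite -mulrnDl -eg gb cb.
    have ac' : a = c by apply: (card_le1_eqP w1); rewrite inE ?aU ?cU.
    by rewrite ac' eqxx in ac.
  have := @card_same_fiber_pairs _ B C b pB.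
  rewrite -(card_double_fiber b) -CK => h; have : (#|C| * #|C|.-1 <= #|C| * 2)%N.
    apply: h; first by apply/subsetP=> c; rewrite !inE => /andP[/andP[]].
    by move=> c; rewrite inE => /andP[_ /eqP].
  case: #|C| => // x; rewrite leq_pmul2l //=.
move: wb bS; set w := #|_|; set x := #|_|.
by case: w => [|[|[|//]]]; lia.
Qed.

Lemma pair_basis_two_torsion G (B : {set G}) : pair_basis B ->
  (#|[set b in B | b *+ 2 == 0%R]| != 1)%N -> (0 < #|[set b in B | b *+ 2 != 0%R]|)%N ->
  #|G| = 4%N \/ #|G| = 16%N /\ #|torsion2 G| = 8%N.
Proof.
move=> pB T1 U0; have := nondegenerate_pairs_bound pB.
have cB := card_pair_basis pB.
rewrite sum_nondegenerate_pairs; rewrite (card_split_torsion B) in cB.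
set T := [set b in B | _ == _] in T1 cB *.
set U := [set b in B | _ != _] in U0 cB *; set S := (X in (_ + X <= _)%N) => bS.
have T0 : 0 \in T by case: pB => B0 _ _ _; rewrite inE B0 mul0rn eqxx.
have T2 : #|T| = 2%N.
  have : (0 < #|T|)%N by apply/card_gt0P; exists 0.
  move: T1 bS; case: #|T| => [|[|[|]]] // t; nia.
have [z zT] : exists z, T = [set 0; z] /\ z != 0.
  have /cards1P[z ez] : #|T :\ 0| == 1%N by rewrite -(eqn_add2l (0%R \in T)) -cardsD1 T2 T0.
  exists z; rewrite -ez setD1K //; split=> //.
  by have : z \in T :\ 0 by [rewrite ez inE]; rewrite !inE => /andP[].
case: zT => eT z0.
have [zB z2] : z \in B /\ z *+ 2 = 0.
  by have : z \in T by [rewrite eT !inE eqxx orbT]; rewrite inE => /andP[? /eqP].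
have [b bU] : exists b, b \in U by apply/card_gt0P.
have S0 : S = 0%N by rewrite T2 in bS; lia.
have Ub : {in U, forall c, c *+ 2 = b *+ 2}.
  move=> c cU; apply/eqP/negPn/negP=> cb.
  have : (0 < #|[set c in U | c *+ 2 != b *+ 2]|)%N.
    by apply/card_gt0P; exists c; rewrite inE cU.
  by move: S0; rewrite /S (bigD1 b) //=; lia.
have b0 : b *+ 2 != 0 by move: bU; rewrite inE => /andP[].
have B0 : 0 \in B by case: pB.
have BTU x : x \in B -> [\/ x = 0, x = z | x \in U].
  move=> xB; have : x \in T :|: U by rewrite !inE xB /= orbN.
  rewrite in_setU eT in_set2 => /orP[/orP[]/eqP->|xU]; [by constructor 1|by constructor 2|].
  by constructor 3.
have UB x : x \in U -> x \in B by rewrite inE => /andP[].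
have neU x : x \in U -> x != 0 /\ x != z.
  rewrite inE => /andP[_ x2]; split; apply: contraNneq x2 => ->; by rewrite ?mul0rn ?z2.
have cE : #|torsion2 G| = (#|U| * 2)%N.
  have zU_inj : injective (+%R z) by apply: addrI.
  rewrite -(card_double_fiber b) muln2 -addnn -[X in (_ + X)%N](card_imset _ zU_inj).
  have dis : #|U :&: +%R z @: U| = 0%N.
    apply/eqP; rewrite cards_eq0; apply/eqP/setP=> x; rewrite !inE; apply/negP.
    move=> /andP[/andP[xB x2] /imsetP[y yU ex]].
    case: pB => _ _ _ inj.
    have [x0 _] : x != 0 /\ x != z by apply: neU; rewrite inE xB.
    have [y0 yz] := neU y yU.
    have e : 0 + x = z + y by rewrite add0r.
    rewrite eq_sym in yz.
    have := inj 0 x z B0 xB zB y (UB _ yU).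
    rewrite eq_sym x0 => /(_ isT yz e) [[e1 _]|[e1 _]].
      by rewrite -e1 eqxx in z0.
    by rewrite -e1 eqxx in y0.
  rewrite -cardsUI dis addn0; congr #|pred_of_set _|; apply/setP=> g.
  apply/idP/setUP => [|[gU|/imsetP[y yU ->]]]; rewrite inE; last first.
  - by rewrite mulrnDl z2 add0r Ub.
  - by rewrite Ub.
  move=> /eqP gb; case: pB => _ cov _ _.
  have [|x [y [xB yB xy eg]]] := cov g; first by apply: contraNneq b0 => g0; rewrite -gb g0 mul0rn.
  have bb : (b *+ 2 == b *+ 2 + b *+ 2) = false.
    by rewrite -{1}[b *+ 2]addr0 (inj_eq (addrI _)) eq_sym (negbTE b0).
  case: (BTU x xB) => [x0|xz|xU]; case: (BTU y yB) => [y0|yz|yU]; subst.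
  - by rewrite eqxx in xy.
  - by move: gb b0; rewrite add0r z2 => ->; rewrite eqxx.
  - by left; rewrite add0r.
  - by move: gb b0; rewrite addr0 z2 => ->; rewrite eqxx.
  - by rewrite eqxx in xy.
  - by right; apply: imset_f.
  - by left; rewrite addr0.
  - by right; rewrite addrC; apply: imset_f.
  - by move: gb; rewrite mulrnDl !Ub // => /esym/eqP; rewrite bb.
have := card_pairs_sum (torsion2 G) pB.
have E1 : #|torsion2 G| = (#|torsion2 G :\ 0%R|).+1 by rewrite (cardsD1 0) inE mul0rn eqxx.
pose m := if b *+ 2 + b *+ 2 == 0 then #|U|.-1 else 0%N.
pose D (x : G) := [set y in B | (y != x) && (x + y \in torsion2 G)].
rewrite (_ : [set p | _] = [set p : G * G | (p.1 \in B) && (p.2 \in D p.1)]); last first.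
  apply/setP=> -[x y]; rewrite !inE /=; case: (x \in B) => //=.
  by case: (y \in B); rewrite ?andbF ?andbT.
have -> : #|[set p : G * G | (p.1 \in B) && (p.2 \in D p.1)]| = (2 + #|U| * m)%N.
  rewrite card_dep_pairs (bigID (mem T)) /=; congr addn.
    rewrite (eq_bigl (mem T)); last by move=> x; rewrite !inE; case: (x \in B).
    rewrite -T2 -[RHS]muln1 -sum_nat_const; apply: eq_bigr => x; rewrite -[mem T x]/(x \in T) => xT.
    have /eqP x2 : x *+ 2 == 0 by move: xT; rewrite inE => /andP[].
    have := T2; rewrite (cardsD1 x) xT => -[<-]; apply: eq_card => y.
    by rewrite !inE mulrnDl x2 add0r; case: (y \in B); rewrite ?andbF.
  rewrite (eq_bigl (mem U)); last by move=> x; rewrite !inE; case: (x \in B).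
  rewrite -sum_nat_const; apply: eq_bigr => x; rewrite -[mem U x]/(x \in U) => xU.
  rewrite /m; case: ifP => b4.
    have := cardsD1 x U; rewrite xU => -> /=; apply: eq_card => y.
    rewrite !inE mulrnDl (Ub x xU); case: (boolP (y \in B)) => yB; rewrite ?andbF //=.
    congr andb; case: (BTU y yB) => [->|->|yU].
    - by rewrite mul0rn addr0 (negbTE b0) eqxx.
    - by rewrite z2 addr0 (negbTE b0) eqxx.
    - by rewrite (Ub y yU) b4 b0.
  apply/eqP; rewrite cards_eq0; apply/eqP/setP=> y; rewrite !inE mulrnDl (Ub x xU).
  apply/negP=> /and3P[yB _]; case: (BTU y yB) => [->|->|yU].
  - by rewrite mul0rn addr0 (negbTE b0).
  - by rewrite z2 addr0 (negbTE b0).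
  - by rewrite (Ub y yU) b4.
rewrite /m T2 in cB *; case: ifP => _.
  move: cE E1 cB U0; set e := #|torsion2 G|; set e' := #|_ :\ _|; set u := #|U|.
  move=> cE E1 cB U0 h; have : (u * u + 4 = 5 * u)%N.
    have : (u * u.-1 + u = u * u)%N by case: (u) => // v; rewrite -mulnSr.
    lia.
  move=> uu; have [u1|u4] : u = 1%N \/ u = 4%N by nia.
    by left; rewrite u1 in cB; lia.
  by right; rewrite u4 in cB cE; lia.
by rewrite muln0; left; have u1 : #|U| = 1%N by [lia]; rewrite u1 in cB; lia.
Qed.

Lemma pair_basis_parts p q : (p %| q)%N -> (0 < p)%N ->
  ((p + q) * (p + q).-1 + 2 = 4 * (p * q))%N -> (2 * (p * q) \in [:: 2; 4; 16])%N.
Proof.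
move=> pq p0 e; have p2 : (p %| 2)%N.
  rewrite -(dvdn_addr (m := ((p + q) * (p + q).-1)%N)); last by rewrite dvdn_mulr // dvdn_addr.
  by rewrite e dvdn_mull // dvdn_mulr.
have : (p <= 2)%N by apply: dvdn_leq.
case: p p0 e {pq p2} => [|[|[|]]] // _ e _.
  have : q = 1%N \/ q = 2%N by move: e; rewrite add1n /=; nia.
  by case=> ->.
have : q = 1%N \/ q = 4%N by move: e; rewrite add2n /=; nia.
by case=> ->.
Qed.

Lemma pair_basis_elementary G (B : {set G}) : pair_basis B ->
  (1 < #|G|)%N -> (forall g : G, g *+ 2 = 0) -> #|G| \in [:: 2; 4; 16]%N.
Proof.
move=> pB G1 G2.
have abG : (2.-abelem [set: G])%g.
  by apply/abelemP=> //; split=> [|g _]; [exact: FinRing.zmod_abelian | exact: G2].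
have pG : (2.-group [set: G])%g := abelem_pgroup abG.
have ntG : [set: G] != 1%g by rewrite -cardG_gt1 cardsT.
have [/eqP e|[M maxM _]] := maximal_exists (sub1G [set: G]).
  by rewrite eq_sym (negbTE ntG) in e.
have MG := maxgroupp maxM; have sMG := proper_sub MG.
have cM : (#|M| * 2 = #|G|)%N.
  by rewrite -cardsT -(Lagrange sMG) (p_maximal_index pG maxM).
have MD x y : x \in M -> (x + y \in M) = (y \in M) by move=> xM; rewrite -[x + y]/(x * y)%g groupMl.
have NM x y : x \notin M -> y \notin M -> x + y \in M.
  move=> xM; apply: contraNT => xyM.
  pose xN := +%R x @: M.
  have dis : #|M :&: xN| = 0%N.
    apply/eqP; rewrite cards_eq0; apply/eqP/setP=> z; rewrite !inE.
    apply/negP=> /andP[zM /imsetP[w wM ez]]; case/negP: xM.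
    by rewrite -(MD w x wM) addrC -ez.
  have : M :|: xN = [set: G].
    apply/eqP; rewrite eqEcard subsetT cardsT -cM cardsU dis subn0 muln2 -addnn.
    by rewrite (card_imset _ (addrI x)) leqnn.
  move/setP/(_ y); rewrite !inE => /orP[//|/imsetP[w wM ey]].
  by case/negP: xyM; rewrite ey addrA -mulr2n G2 add0r.
pose p := #|B :&: M|; pose q := #|B :\: M|.
have cB : (#|B| = p + q)%N by rewrite cardsID.
have pq : (2 * (p * q) = #|G|)%N.
  have := card_pairs_sum (~: M) pB.
  pose D (x : G) := if x \in M then B :\: M else B :&: M.
  have -> : [set p : G * G | [&& p.1 \in B, p.2 \in B :\ p.1 & p.1 + p.2 \in ~: M]] =
            [set p : G * G | (p.1 \in B) && (p.2 \in D p.1)].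
    apply/setP=> -[x y]; rewrite !inE /D /=; case: (x \in B) => //=.
    case: ifP => xM; rewrite !inE; case: (boolP (y \in B)) => yB; rewrite ?andbF ?andbT //=.
      by rewrite MD //; case: eqP => //= ->; rewrite xM.
    case: (boolP (y \in M)) => yM.
      rewrite addrC MD // xM andbT; apply: contraFneq xM => <-; exact: yM.
    by rewrite NM ?xM ?andbF.
  rewrite card_dep_pairs (big_setID M) /=.
  rewrite (eq_bigr (fun=> q)); last by move=> x; rewrite inE /D => /andP[_ ->].
  rewrite sum_nat_const (eq_bigr (fun=> p)); last first.
    by move=> x; rewrite inE /D => /andP[/negbTE-> _].
  rewrite sum_nat_const -/p -/q.
  have -> : ~: M :\ 0 = ~: M.
    apply/setDidPl; rewrite disjoint_sym disjoints1 inE negbK; exact: (group1 M).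
  rewrite (mulnC q p); have := cardsC M; rewrite -cM.
  by rewrite muln2 -addnn => /addnI ->; rewrite muln2 -addnn mul2n -addnn.
have cG := card_pair_basis pB; rewrite cB in cG.
have [n en] := p_natP pG; rewrite cardsT in en.
have [i pi] : exists i, p = (2 ^ i)%N.
  have : (p %| 2 ^ n)%N by rewrite -en -pq dvdn_mull // dvdn_mulr.
  by case/(dvdn_pfactor _ _ (isT : prime 2)) => i _ ->; exists i.
have [j qj] : exists i, q = (2 ^ i)%N.
  have : (q %| 2 ^ n)%N by rewrite -en -pq dvdn_mull // dvdn_mull.
  by case/(dvdn_pfactor _ _ (isT : prime 2)) => i' _ ->; exists i'.
rewrite -pq; case: (leqP i j) => ij.
  by apply: pair_basis_parts; rewrite ?pi ?qj ?dvdn_exp2l ?expn_gt0 // -pi -qj; lia.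
rewrite (mulnC p); apply: pair_basis_parts; rewrite ?pi ?qj ?dvdn_exp2l ?expn_gt0 ?(ltnW ij) //.
by rewrite -pi -qj addnC; lia.
Qed.

Lemma abelian_type_Z2Z2Z4 (gT : finGroupType) : #|gT| = 16%N -> abelian [set: gT] ->
  #|[set x : gT | (x ^+ 2)%g == 1%g]| = 8%N -> abelian_type [set: gT] = [:: 4; 2; 2]%N.
Proof.
move=> c16 abT c8; have cT : #|[set: gT]| = 16%N by rewrite cardsT.
have pT : (2.-group [set: gT])%g by rewrite /pgroup cT.
have := size_abelian_type abT; rewrite (rank_abelian_pgroup pT abT).
rewrite (OhmEabelian pT); last by apply: abelianS abT; apply: subsetT.
rewrite setTI expn1 c8 (_ : logn 2 8 = 3%N) //.
have := abelian_type_gt1 [set: gT]; have := abelian_type_dvdn_sorted [set: gT].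
have := abelian_structure abT; move: cT => + [s dprodT <-].
rewrite -(bigdprod_card dprodT).
case: s {dprodT} => [|x [|y [|z [|]]]] //=; rewrite !big_cons big_nil muln1.
rewrite -!orderE => c /and3P[yx zy _] /and4P[x1 y1 z1 _] _.
move: c yx zy x1 y1 z1; set a := #[x]%g; set b := #[y]%g; set d := #[z]%g.
move=> c yx zy a1 b1 d1.
have ba : (b <= a)%N by apply: dvdn_leq => //; apply: ltnW.
have db : (d <= b)%N by apply: dvdn_leq => //; apply: ltnW.
have d2 : (d <= 2)%N.
  have : (d * (d * d) <= 16)%N by rewrite -c; apply: leq_mul; [apply: leq_trans ba | apply: leq_mul].
  nia.
have b2 : (b <= 3)%N.
  rewrite leqNgt; apply/negP=> b4; have : (4 * (4 * 2) <= 16)%N by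
    rewrite -c; apply: leq_mul; [apply: leq_trans ba | apply: leq_mul].
  by [].
have {d1}d2 : d = 2%N by lia.
rewrite d2 in c zy *.
have {b1}b2 : b = 2%N by move: b1 b2 zy; case: (b) => [|[|[|[|]]]].
by rewrite b2 in c *; congr cons; lia.
Qed.

Lemma Z2_mulg (a : 'Z_2) : (a * a = 1)%g.
Proof. by apply: val_inj; case: a => [[|[|]]]. Qed.

Lemma prod_abelian (gT rT : finGroupType) :
  abelian [set: gT] -> abelian [set: rT] -> abelian [set: gT * rT].
Proof.
move=> /centsP aG /centsP aR; apply/centsP=> -[a b] _ [c d] _.
by congr pair; [apply: aG | apply: aR]; rewrite inE.
Qed.

Lemma Zp_abelianT n : abelian [set: 'Z_n].
Proof. exact: FinRing.zmod_abelian. Qed.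

Lemma isog_order4 G : #|G| = 4%N ->
  ([set: G] \isog [set: 'Z_4]) || ([set: G] \isog [set: 'Z_2 * 'Z_2]).
Proof.
move=> c4; have cT : #|[set: G]| = 4%N by rewrite cardsT.
have abG : abelian [set: G] := FinRing.zmod_abelian _.
case: (boolP (cyclic [set: G])) => cy.
  by rewrite isog_cyclic_card // cT cardsT card_ord andbT; apply/orP; left; apply/cyclicP; exists 1; exact: Zp_cycle.
apply/orP; right; rewrite (@isog_abelem_card _ _ 2); last first.
  apply/abelemP => //; split=> // x _; apply/eqP; rewrite -order_dvdn.
  have : (#[x]%g %| 4)%N by rewrite -cT order_dvdG ?inE.
  have x4 : #[x]%g != 4%N.
    apply: contraNneq cy => x4; apply/cyclicP; exists x; apply/esym/eqP.
    by rewrite eqEcard subsetT cT -orderE x4.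
  case: #[x]%g x4 => [|[|[|[|[|]]]]] //= n _ /dvdn_leq; lia.
rewrite cT cardsT card_prod !card_ord eqxx andbT.
apply/abelemP=> //; split; first by apply: prod_abelian; apply: Zp_abelianT.
by move=> -[a b] _; congr pair; apply: Z2_mulg.
Qed.

Lemma isog_elementary16 G : #|G| = 16%N -> (forall g : G, g *+ 2 = 0) ->
  [set: G] \isog [set: 'Z_2 * 'Z_2 * 'Z_2 * 'Z_2].
Proof.
move=> c16 G2; rewrite (@isog_abelem_card _ _ 2); last first.
  by apply/abelemP=> //; split=> [|g _]; [exact: FinRing.zmod_abelian | exact: G2].
rewrite !cardsT c16 !card_prod !card_ord andbT.
apply/abelemP=> //; split; first by do !apply: prod_abelian; apply: Zp_abelianT.
by move=> -[[[a b] c] d] _; do !congr pair; apply: Z2_mulg.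
Qed.

Lemma isog_Z2Z2Z4 G : #|G| = 16%N -> #|torsion2 G| = 8%N ->
  [set: G] \isog [set: 'Z_2 * 'Z_2 * 'Z_4].
Proof.
move=> c16 c8; rewrite eq_abelian_type_isog ?FinRing.zmod_abelian //; last first.
  by do !apply: prod_abelian; apply: Zp_abelianT.
rewrite !abelian_type_Z2Z2Z4 ?FinRing.zmod_abelian ?card_prod ?card_ord //.
  by do !apply: prod_abelian; apply: Zp_abelianT.
pose K := [set a : 'Z_4 | (a * a == 1)%g].
have -> : [set x : 'Z_2 * 'Z_2 * 'Z_4 | (x ^+ 2)%g == 1%g] = setX setT K.
  apply/setP=> -[[a b] c]; rewrite !inE /=.
  rewrite -[((a, b, c) ^+ 2)%g]/((a * a)%g, (b * b)%g, (c * c)%g) !Z2_mulg.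
  by rewrite xpair_eqE eqxx.
have -> : K = [set 0; 2].
  by apply/setP=> -[[|[|[|[|]]]] i] //; rewrite !inE.
by rewrite cardsX cardsT card_prod !card_ord cards2.
Qed.

Lemma isog_prime_Zp G p : prime p -> #|G| = p -> [set: G] \isog [set: 'Z_p].
Proof.
move=> pp cG; have cT : #|[set: G]| = p by rewrite cardsT.
have cZ : #|[set: 'Z_p]| = p by rewrite cardsT card_ord Zp_cast ?prime_gt1.
by rewrite isog_cyclic_card ?prime_cyclic ?cT ?cZ //= eqxx prime_cyclic ?cZ.
Qed.

Lemma pair_basis_odd G (B : {set G}) : pair_basis B -> odd #|G| -> (#|B| <= 4)%N.
Proof.
move=> pB oG; have := nondegenerate_pairs_bound pB.
have dbl_inj : injective (fun g : G => g *+ 2).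
  move=> x y /eqP; rewrite -subr_eq0 -mulrnBl -[_ *+ 2]/((x - y) ^+ 2)%g -order_dvdn => o2.
  have : #[x - y]%g == 1%N.
    rewrite -dvdn1 -(_ : gcdn 2 #|G| = 1%N) ?dvdn_gcd ?o2; last by apply/eqP; rewrite -[_ == _]/(coprime _ _) coprime2n.
    by rewrite -cardsT order_dvdG ?inE.
  by rewrite order_eq1 -[1%g]/(0 : G) subr_eq0 => /eqP.
have B0 : 0 \in B by case: pB.
rewrite (eq_bigr (fun=> #|B|.-1)); last first.
  move=> b bB; rewrite (cardsD1 b B) bB; apply: eq_card => c.
  by rewrite !inE (inj_eq dbl_inj) andbC.
have -> : [set b in B | b *+ 2 != 0] = B :\ 0.
  by apply/setP=> b; rewrite !inE -(mul0rn _ 2) (inj_eq dbl_inj) andbC.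
rewrite sum_nat_const (cardsD1 0 B) B0 /= add1n.
by case: #|B :\ 0| => // m; rewrite leq_pmul2r.
Qed.

Lemma pair_basis_classification G (B : {set G}) : pair_basis B -> (1 < #|G|)%N ->
  [\/ #|G| \in [:: 2; 4; 7]%N,
      #|G| = 16%N /\ (forall g : G, g *+ 2 = 0) |
      #|G| = 16%N /\ #|torsion2 G| = 8%N].
Proof.
move=> pB G1.
case: (posnP #|[set b in B | b *+ 2 != 0]|) => [U0|U0].
  have B2 b : b \in B -> b *+ 2 = 0.
    move=> bB; apply/eqP/negPn/negP=> b2.
    by have /setP/(_ b) := cards0_eq U0; rewrite !inE bB b2.
  have G2 (g : G) : g *+ 2 = 0.
    have [->|g0] := eqVneq g 0; first by rewrite mul0rn.
    case: pB => _ cov _ _; have [a [b [aB bB _ ->]]] := cov g g0.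
    by rewrite mulrnDl !B2 // addr0.
  have := pair_basis_elementary pB G1 G2; rewrite !inE => /or3P[]/eqP cG.
  - by constructor 1; rewrite cG.
  - by constructor 1; rewrite cG.
  - by constructor 2.
have [T1|T1] := eqVneq #|[set b in B | b *+ 2 == 0]| 1%N; last first.
  by have [->|?] := pair_basis_two_torsion pB T1 U0; [constructor 1 | constructor 3].
have eT : [set b in B | b *+ 2 == 0] = [set 0].
  have /cards1P[x ex] : #|[set b in B | b *+ 2 == 0]| == 1%N by rewrite T1.
  have : 0 \in [set b in B | b *+ 2 == 0] by case: pB => B0 _ _ _; rewrite inE B0 mul0rn eqxx.
  by rewrite ex inE => /eqP ->.
have cB := card_pair_basis pB; have oB := pair_basis_odd pB.
have B5 := pair_basis_one_torsion pB eT U0; constructor 1; rewrite !inE.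
move: cB oB B5; case: #|B| => [|[|[|[|[|[|//]]]]]] cB oB _; last first.
  by have e11 : #|G| = 11%N by [lia]; rewrite e11 in oB; have := oB isT.
all: lia.
Qed.

End PerfectBases.

Theorem theorem3 (G : finZmodType) (G_nontrivial : 1 < #|G|) :
  (exists A : {set G}, perfect_restricted_basis 2 A) <->
  [|| [set: G] \isog [set: 'Z_2],
      [set: G] \isog [set: 'Z_4],
      [set: G] \isog [set: 'Z_7],
      [set: G] \isog [set: 'Z_2 * 'Z_2],
      [set: G] \isog [set: 'Z_2 * 'Z_2 * 'Z_2 * 'Z_2]
    | [set: G] \isog [set: 'Z_2 * 'Z_2 * 'Z_4]].
Proof.
split=> [[A /perfect_pair_basis pB]|]; last exact: perfect_basis_exists.
have [|[cG G2]|[cG c8]] := pair_basis_classification pB G_nontrivial.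
- rewrite !inE => /or3P[]/eqP cG.
  + by rewrite (isog_prime_Zp _ cG).
  + by case/orP: (isog_order4 cG) => ->; rewrite ?orbT.
  + by rewrite (isog_prime_Zp _ cG) ?orbT.
- by rewrite (isog_elementary16 cG G2) ?orbT.
- by rewrite (isog_Z2Z2Z4 cG c8) ?orbT.
Qed.
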